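(* Let $n\ge m$, let $a=(a_0,\dots,a_{n-1})$ be an arbitrary sequence, and let $f\colon[0,m)\to\mathbb{R}$ be a concave function accessible through an evaluation oracle $\mathrm{EVO}$; put $b_i=f(i)$ for $i\in\{0,\dots,m-1\}$. Then the sequence $c_k=\min_{0\le i\le m-1}\{a_{k+i}+b_i\}$, $k\in\{0,\dots,n-m\}$, can be computed by an algorithm whose arithmetic complexity and $\mathrm{EVO}$-oracle complexity are both bounded by $O\bigl(n^{4/3}\cdot\log^2(n)\bigr)$.
   Context: The evaluation oracle $\mathrm{EVO}$, given $x\in\mathrm{dom}(f)$, returns $f(x)$ (and can compare values of $f$ at two points). Complexity is measured as the number of elementary arithmetic operations and oracle calls. *)

(* Defs.v *)
From HB Require Import structures.
From mathcomp Require Import all_boot all_order all_algebra.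
From mathcomp Require Import all_classical all_reals all_analysis.

Set Implicit Arguments.
Unset Strict Implicit.
Unset Printing Implicit Defensive.

Import Order.TTheory GRing.Theory Num.Theory.
Import numFieldNormedType.Exports.
Local Open Scope ring_scope.

(* The model of computation is a uniform real RAM with an evaluation oracle,
   presented as a structured imperative language.  A program has finitely many
   unbounded arrays of naturals and of reals, named by literals of type nat;
   cell 0 of an array serves as a scalar variable.  The cells of an array are
   addressed by computed indices.

   The syntax contains no real literal and does not mention R, n, m or f, so
   that a program is a single finite text for all inputs; reals only arise from
   the input, from naturals, by the field operations and by oracle calls.

   Arithmetic on naturals is restricted to +, truncated - and halving.  There
   is no multiplication of naturals and no rounding of reals, so the lengths of
   naturals grow by at most one bit per operation and the unit-cost measure
   cannot be abused. *)

Inductive nexp :=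
| NConst of nat
| NGet of nat & nexp            (* array name, index *)
| NAdd of nexp & nexp
| NSub of nexp & nexp
| NHalf of nexp.

Inductive rexp :=
| RNat of nexp
| RGet of nat & nexp
| RAdd of rexp & rexp
| RSub of rexp & rexp
| RMul of rexp & rexp
| RDiv of rexp & rexp
| REvo of rexp.                 (* value of f at a point *)

Inductive bexp :=
| BNle of nexp & nexp
| BRle of rexp & rexp
| BEvole of rexp & rexp         (* f x <= f y, as a single oracle call *)
| BNot of bexp
| BAnd of bexp & bexp.

Inductive com :=
| Skip
| NPut of nat & nexp & nexp     (* array name, index, value *)
| RPut of nat & nexp & rexp
| Seq of com & com
| If of bexp & com & com
| While of bexp & com.

(* Elementary operations performed by one evaluation of an expression, oracle
   calls excluded.  Constants and memory accesses are charged too.  Evaluation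
   is strict (in BAnd as well), so this is the number of nodes. *)
Fixpoint ncost (e : nexp) : nat :=
  match e with
  | NConst _ => 1
  | NGet _ e1 | NHalf e1 => (ncost e1).+1
  | NAdd e1 e2 | NSub e1 e2 => (ncost e1 + ncost e2).+1
  end.

Fixpoint rcost (e : rexp) : nat :=
  match e with
  | RNat e1 | RGet _ e1 => (ncost e1).+1
  | RAdd e1 e2 | RSub e1 e2 | RMul e1 e2 | RDiv e1 e2 =>
      (rcost e1 + rcost e2).+1
  | REvo e1 => rcost e1
  end.

Fixpoint bcost (b : bexp) : nat :=
  match b with
  | BNle e1 e2 => (ncost e1 + ncost e2).+1
  | BRle e1 e2 => (rcost e1 + rcost e2).+1
  | BEvole e1 e2 => (rcost e1 + rcost e2)%N
  | BNot b1 => (bcost b1).+1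
  | BAnd b1 b2 => (bcost b1 + bcost b2).+1
  end.

Fixpoint rcalls (e : rexp) : nat :=
  match e with
  | RNat _ | RGet _ _ => 0
  | RAdd e1 e2 | RSub e1 e2 | RMul e1 e2 | RDiv e1 e2 =>
      (rcalls e1 + rcalls e2)%N
  | REvo e1 => (rcalls e1).+1
  end.

Fixpoint bcalls (b : bexp) : nat :=
  match b with
  | BNle _ _ => 0
  | BRle e1 e2 => (rcalls e1 + rcalls e2)%N
  | BEvole e1 e2 => (rcalls e1 + rcalls e2).+1
  | BNot b1 => bcalls b1
  | BAnd b1 b2 => (bcalls b1 + bcalls b2)%N
  end.

Record state (R : Type) := State {
  nmem : nat -> nat -> nat;     (* array name, index *)
  rmem : nat -> nat -> R }.

Definition upd (A : Type) (M : nat -> nat -> A) (x i : nat) (v : A) :=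
  fun y j => if (y == x) && (j == i) then v else M y j.

Definition nput (R : Type) (s : state R) (x i v : nat) : state R :=
  State (upd (nmem s) x i v) (rmem s).

Definition rput (R : Type) (s : state R) (x i : nat) (v : R) : state R :=
  State (nmem s) (upd (rmem s) x i v).

Definition lift2 (A B : Type) (h : A -> A -> B) (u v : option A) : option B :=
  obind (fun x => omap (h x) v) u.

Fixpoint neval (R : Type) (s : state R) (e : nexp) : nat :=
  match e with
  | NConst c => c
  | NGet x e1 => nmem s x (neval s e1)
  | NAdd e1 e2 => (neval s e1 + neval s e2)%N
  | NSub e1 e2 => (neval s e1 - neval s e2)%N
  | NHalf e1 => (neval s e1)./2
  end.

(* None is a failure: a division by zero, or an oracle query at a point where
   the oracle F is undefined. *)
Fixpoint reval (R : realType) (F : R -> option R) (s : state R) (e : rexp) :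
    option R :=
  match e with
  | RNat e1 => Some (neval s e1)%:R
  | RGet x e1 => Some (rmem s x (neval s e1))
  | RAdd e1 e2 => lift2 +%R (reval F s e1) (reval F s e2)
  | RSub e1 e2 => lift2 (fun x y => x - y) (reval F s e1) (reval F s e2)
  | RMul e1 e2 => lift2 *%R (reval F s e1) (reval F s e2)
  | RDiv e1 e2 =>
      obind (fun v => if v == 0 then None
                      else omap (fun u => u / v) (reval F s e1))
            (reval F s e2)
  | REvo e1 => obind F (reval F s e1)
  end.

Fixpoint beval (R : realType) (F : R -> option R) (s : state R) (b : bexp) :
    option bool :=
  match b with
  | BNle e1 e2 => Some (neval s e1 <= neval s e2)%N
  | BRle e1 e2 => lift2 (fun x y => x <= y) (reval F s e1) (reval F s e2)
  | BEvole e1 e2 =>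
      lift2 (fun x y => x <= y)
            (obind F (reval F s e1)) (obind F (reval F s e2))
  | BNot b1 => omap negb (beval F s b1)
  | BAnd b1 b2 => lift2 andb (beval F s b1) (beval F s b2)
  end.

(* exec F c s s' t q: started in s, the program c terminates without failure in
   s', after t elementary operations and q calls to the oracle F. *)
Inductive exec (R : realType) (F : R -> option R) :
    com -> state R -> state R -> nat -> nat -> Prop :=
| ExecSkip s : exec F Skip s s 0 0
| ExecNPut s x i e :
    exec F (NPut x i e) s (nput s x (neval s i) (neval s e))
         (ncost i + ncost e).+1 0
| ExecRPut s x i e v : reval F s e = Some v ->
    exec F (RPut x i e) s (rput s x (neval s i) v)
         (ncost i + rcost e).+1 (rcalls e)
| ExecSeq c1 c2 s1 s2 s3 t1 t2 q1 q2 :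
    exec F c1 s1 s2 t1 q1 -> exec F c2 s2 s3 t2 q2 ->
    exec F (Seq c1 c2) s1 s3 (t1 + t2)%N (q1 + q2)%N
| ExecIf b c1 c2 s s' v t q :
    beval F s b = Some v -> exec F (if v then c1 else c2) s s' t q ->
    exec F (If b c1 c2) s s' (bcost b + t).+1 (bcalls b + q)%N
| ExecWhileF b c s : beval F s b = Some false ->
    exec F (While b c) s s (bcost b).+1 (bcalls b)
| ExecWhileT b c s1 s2 s3 t1 t2 q1 q2 :
    beval F s1 b = Some true -> exec F c s1 s2 t1 q1 ->
    exec F (While b c) s2 s3 t2 q2 ->
    exec F (While b c) s1 s3 (bcost b + t1 + t2).+1 (bcalls b + q1 + q2)%N.

Lemma exec_det (R : realType) (F : R -> option R) c s s1 s2 t1 t2 q1 q2 :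
  exec F c s s1 t1 q1 -> exec F c s s2 t2 q2 ->
  [/\ s1 = s2, t1 = t2 & q1 = q2].
Proof.
move=> H; elim: H s2 t2 q2 => {c s s1 t1 q1}.
- by move=> s s2 t2 q2 H; inversion H.
- by move=> s x i e s2 t2 q2 H; inversion H.
- move=> s x i e v ev s2 t2 q2 H; inversion H; subst.
  by have [->] : Some v = Some v0 by congruence.
- move=> c1 c2 s1 s2 s3 t1 t2 q1 q2 _ IH1 _ IH2 s' t' q' H.
  inversion H as [| | |? ? ? s4 ? ? ? ? ? E1 E2| | |]; subst.
  have [? ? ?] := IH1 _ _ _ E1; subst.
  by have [-> -> ->] := IH2 _ _ _ E2.
- move=> b c1 c2 s s1 v t1 q1 ev _ IH s2 t2 q2 H.
  inversion H as [| | | |? ? ? ? ? v' ? ? ev' E| |]; subst.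
  have vv' : v' = v by congruence.
  by subst v'; have [-> -> ->] := IH _ _ _ E.
- move=> b c s ev s2 t2 q2 H; inversion H => //; congruence.
- move=> b c s1 s2 s3 t1 t2 q1 q2 ev _ IH1 _ IH2 s' t' q' H.
  inversion H as [| | | | | |? ? ? s4 ? ? ? ? ? ev' E1 E2]; subst.
    congruence.
  have [? ? ?] := IH1 _ _ _ E1; subst.
  by have [-> -> ->] := IH2 _ _ _ E2.
Qed.

(* The oracle of f, whose domain is the real interval [0, m): values of
   f : R -> R outside it are inaccessible. *)
Definition EVO (R : realType) (m : nat) (f : R -> R) (x : R) : option R :=
  if (0 <= x) && (x < m%:R) then Some (f x) else None.

Definition concave_function (R : realType) (D : set R) (f : R -> R) : Prop :=
  @convex_function R R^o D (fun x => - f x).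

(* Input: n and m in cell 0 of the arrays of naturals 0 and 1, and a_0, ...,
   a_(n-1) in the array of reals 0; every other cell holds 0. *)
Definition input (R : realType) (n m : nat) (a : n.-tuple R) : state R :=
  State (upd (upd (fun _ _ => 0%N) 0 0 n) 1 0 m)
        (fun x i => if x == 0%N then a`_i else 0).

Definition output (R : realType) (s : state R) (k : nat) : R := rmem s 1 k.

(* c_k; the term of index 0, which is present since m > 0, is used as the
   starting value of the minimum. *)
Definition min_plus (R : realType) (n m : nat) (a : n.-tuple R) (f : R -> R)
    (k : nat) : R :=
  \big[Num.min/(a`_k + f 0)]_(0 <= i < m) (a`_(k + i) + f i%:R).

(* Main.v *)
(* Put v(k, j) = a_j + f(j - k).  Concavity of f makes v inverse Monge: if k <= k'
   and j <= j', then v(k, j) + v(k', j') >= v(k, j') + v(k', j).  Hence for two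
   adjacent blocks of columns inside the band k <= j < k + m, once the left block
   contains the smaller entry of some row it does so for all later rows, and the
   pair of blocks is summarised by a single crossover row.

   For all l and s with 2^(l+1) <= m, the crossover of the two halves of
   [s, s + 2^(l+1)) is found by binary search on the rows.  The minimum of a row
   over a block is located by descending through the crossovers already known,
   halving the block at each step.  Finally [k, k + m) is the union of two blocks
   of length 2^L, where 2^L <= m < 2^(L+1).  All of this costs O(n log^3 n), and
   log n = O(n^(1/3)). *)
Require Import Defs.
From HB Require Import structures.
From mathcomp Require Import all_boot all_order all_algebra.
From mathcomp Require Import all_classical all_reals all_analysis.
From mathcomp Require Import zify ring lra.
Import Order.TTheory GRing.Theory Num.Theory.
Import numFieldNormedType.Exports.
Local Open Scope classical_set_scope.
Local Open Scope ring_scope.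

Set Implicit Arguments.
Unset Strict Implicit.

(** * Concavity and the inverse Monge property of the entries *)

(** The points y and x + d are convex combinations of x and y + d with swapped weights; adding the
    two concavity inequalities gives the claim. *)
Lemma concave_exchange (R : realType) (D : set R) (f : R -> R) (x y d : R) :
  concave_function D f -> 0 <= d -> x <= y ->
  D x -> D (y + d) ->
  f x + f (y + d) <= f (x + d) + f y.
Proof.
move=> cf d0 xy Dx Dz.
have [z0|z0] := eqVneq (y + d - x) 0.
  have -> : d = 0 by lra.
  by rewrite !addr0.
have zp : 0 < y + d - x by rewrite lt_neqAle eq_sym z0/=; lra.
(* With this weight, y = u x + (1 - u)(y + d) and x + d = u (y + d) + (1 - u) x. *)
pose u := d / (y + d - x).
have u0 : 0 <= u by rewrite divr_ge0// ltW.
have u1 : u <= 1 by rewrite ler_pdivrMr// mul1r; lra.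
have ud : u * (y + d - x) = d by rewrite divfK.
have iu : Itv.spec (Itv.num_sem (R := R)) (Itv.Real `[0%Z, 1%Z]) u.
  by rewrite /Itv.spec /= /Itv.num_sem /= num_real /= in_itv /= u0 u1.
pose t : {i01 R} := Itv.mk iu.
have Dx' : x \in D by rewrite inE.
have Dz' : y + d \in D by rewrite inE.
have := cf t _ _ Dz' Dx'; have := cf t _ _ Dx' Dz'.
(* The convex combinations of points and of values live in two structures on R. *)
have e1 (p q : R) : conv t (p : convex_lmodType R^o) q = u * p + (1 - u) * q by [].
have e2 (p q : R) : conv t (p : R^o) q = u * p + (1 - u) * q by [].
rewrite !e1 !e2.
have -> : u * x + (1 - u) * (y + d) = y.
  by rewrite -[RHS](addrK d) -{3}ud; ring.
have -> : u * (y + d) + (1 - u) * x = x + d by rewrite -{2}ud; ring.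
lra.
Qed.

Definition entry (R : realType) (a : nat -> R) (f : R -> R) (k j : nat) : R :=
  a j + f (j - k)%N%:R.

(** A column is exhibited instead of comparing two block minima; in a tie both blocks win. *)
Definition wins (R : realType) (a : nat -> R) (f : R -> R) (k s1 s2 h : nat) :=
  exists2 j, (s1 <= j < s1 + h)%N &
    forall j', (s2 <= j' < s2 + h)%N -> entry a f k j <= entry a f k j'.

Definition argmin (R : realType) (a : nat -> R) (f : R -> R) (k s h j : nat) :=
  (s <= j < s + h)%N /\
  forall j', (s <= j' < s + h)%N -> entry a f k j <= entry a f k j'.

(** Concavity is applied at j - k' and j' - k' with shift k' - k; the bounds k' <= j and j' < k + m
    keep all four points in [0, m). *)
Lemma entry_exchange (R : realType) (m : nat) (a : nat -> R) (f : R -> R)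
    (k k' j j' : nat) :
  concave_function [set x | 0 <= x < m%:R] f ->
  (k <= k')%N -> (k' <= j)%N -> (j <= j')%N -> (j' < k + m)%N ->
  entry a f k j <= entry a f k j' -> entry a f k' j <= entry a f k' j'.
Proof.
move=> cf kk kj jj jm; rewrite /entry.
have := @concave_exchange R [set x | 0 <= x < m%:R] f
  (j - k')%N%:R (j' - k')%N%:R (k' - k)%N%:R cf.
rewrite -!natrD ler0n ler_nat.
have -> : (j' - k' + (k' - k) = j' - k)%N by lia.
have -> : (j - k' + (k' - k) = j - k)%N by lia.
move=> /(_ isT) H H1.
have {}H : f (j - k')%N%:R + f (j' - k)%N%:R <= f (j - k)%N%:R + f (j' - k')%N%:R.
  by apply: H; rewrite /= ?ler0n ?ltr_nat; lia.
lra.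
Qed.

Lemma wins_mono (R : realType) (m : nat) (a : nat -> R) (f : R -> R)
    (k k' s h : nat) :
  concave_function [set x | 0 <= x < m%:R] f ->
  (k <= k')%N -> (k' <= s)%N -> (s + h + h <= k + m)%N ->
  wins a f k s (s + h)%N h -> wins a f k' s (s + h)%N h.
Proof.
move=> cf kk ks sm [j jb jw]; exists j => // j' jb'.
by apply: (@entry_exchange R m _ _ k) => //; try lia; exact: jw.
Qed.

(** Because of ties this is not the contrapositive of [wins_mono]: the exchange inequality is used
    again, now to exclude a left column that is strictly smaller in row k'. *)
Lemma wins_antimono (R : realType) (m : nat) (a : nat -> R) (f : R -> R)
    (k k' s h : nat) :
  concave_function [set x | 0 <= x < m%:R] f ->
  (k' <= k)%N -> (k <= s)%N -> (s + h + h <= k' + m)%N ->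
  wins a f k (s + h)%N s h -> wins a f k' (s + h)%N s h.
Proof.
move=> cf kk ks sm [j jb jw]; exists j => // j' jb'.
rewrite leNgt; apply/negP => lt.
have := @concave_exchange R [set x | 0 <= x < m%:R] f (j' - k)%N%:R (j - k)%N%:R (k - k')%N%:R cf.
rewrite -!natrD ler0n ler_nat.
have -> : (j' - k + (k - k') = j' - k')%N by lia.
have -> : (j - k + (k - k') = j - k')%N by lia.
move=> /(_ isT) H.
have {}H : f (j' - k)%N%:R + f (j - k')%N%:R <= f (j' - k')%N%:R + f (j - k)%N%:R.
  by apply: H; rewrite /= ?ler0n ?ltr_nat; lia.
have := jw _ jb'; move: lt; rewrite /entry; lra.
Qed.

(** * Minima of adjacent blocks *)

Lemma argmin_left (R : realType) (a : nat -> R) (f : R -> R) (k s h j : nat) :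
  wins a f k s (s + h)%N h -> argmin a f k s h j -> argmin a f k s (h + h) j.
Proof.
move=> [j0 j0b j0w] [jb jm]; split; first lia.
move=> j' jb'; have [lt|ge] := ltnP j' (s + h); first by apply: jm; lia.
by apply: (le_trans (jm _ j0b)); apply: j0w; lia.
Qed.

Lemma argmin_right (R : realType) (a : nat -> R) (f : R -> R) (k s h j : nat) :
  wins a f k (s + h)%N s h -> argmin a f k (s + h)%N h j ->
  argmin a f k s (h + h) j.
Proof.
move=> [j0 j0b j0w] [jb jm]; split; first lia.
move=> j' jb'; have [lt|ge] := ltnP j' (s + h); last by apply: jm; lia.
by apply: (le_trans (jm _ j0b)); apply: j0w; lia.
Qed.

Lemma argmin_wins (R : realType) (a : nat -> R) (f : R -> R)
    (k s1 s2 h j1 j2 : nat) :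
  argmin a f k s1 h j1 -> argmin a f k s2 h j2 ->
  entry a f k j1 <= entry a f k j2 -> wins a f k s1 s2 h.
Proof.
move=> [b1 _] [_ m2] le12; exists j1 => // j' jb'.
exact: le_trans le12 (m2 _ jb').
Qed.

(** * Execution with a budget for operations and oracle calls together *)

Definition runs (R : realType) (F : R -> option R) (c : com) (s : state R)
    (B : nat) (P : state R -> Prop) :=
  exists s' t q, [/\ exec F c s s' t q, (t + q <= B)%N & P s'].

Lemma runs_le (R : realType) (F : R -> option R) c s B B' P P' :
  runs F c s B P -> (B <= B')%N -> (forall s', P s' -> P' s') ->
  runs F c s B' P'.
Proof.
move=> [s' [t [q [E tq p]]]] BB PP; exists s', t, q; split; [done|lia|exact: PP].
Qed.

Lemma runs_skip (R : realType) (F : R -> option R) s B P :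
  P s -> runs F Skip s B P.
Proof. by move=> p; exists s, 0%N, 0%N; split=> //; constructor. Qed.

Lemma runs_nput (R : realType) (F : R -> option R) x i e s B P :
  P (nput s x (neval s i) (neval s e)) -> (ncost i + ncost e < B)%N ->
  runs F (NPut x i e) s B P.
Proof.
move=> p b; exists (nput s x (neval s i) (neval s e)).
by exists (ncost i + ncost e).+1, 0%N; split; [constructor|lia|].
Qed.

Lemma runs_rput (R : realType) (F : R -> option R) x i e v s B P :
  reval F s e = Some v -> P (rput s x (neval s i) v) ->
  (ncost i + rcost e + rcalls e < B)%N ->
  runs F (RPut x i e) s B P.
Proof.
move=> ev p b; exists (rput s x (neval s i) v).
by exists (ncost i + rcost e).+1, (rcalls e); split; [constructor|lia|].
Qed.

(** The second command runs inside the postcondition of the first, on the budget left over, so a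
    program is verified from front to back. *)
Lemma runs_seq (R : realType) (F : R -> option R) c1 c2 s B1 B P :
  runs F c1 s B1 (fun s1 => runs F c2 s1 (B - B1) P) -> (B1 <= B)%N ->
  runs F (Seq c1 c2) s B P.
Proof.
move=> [s1 [t1 [q1 [E1 b1 [s2 [t2 [q2 [E2 b2 p]]]]]]]] B1B.
exists s2, (t1 + t2)%N, (q1 + q2)%N; split => //; last lia.
exact: ExecSeq E1 E2.
Qed.

Lemma runs_nput_seq (R : realType) (F : R -> option R) x i e c s B P :
  (ncost i + ncost e < B)%N ->
  runs F c (nput s x (neval s i) (neval s e)) (B - (ncost i + ncost e).+1) P ->
  runs F (Seq (NPut x i e) c) s B P.
Proof.
move=> b H; apply: (@runs_seq _ _ _ _ _ (ncost i + ncost e).+1) => //.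
exact: runs_nput.
Qed.

Lemma runs_if (R : realType) (F : R -> option R) b c1 c2 v s B P :
  beval F s b = Some v ->
  runs F (if v then c1 else c2) s (B - (bcost b + bcalls b).+1) P ->
  (bcost b + bcalls b < B)%N ->
  runs F (If b c1 c2) s B P.
Proof.
move=> ev [s' [t [q [E tq p]]]] bB.
exists s', (bcost b + t).+1, (bcalls b + q)%N; split => //; last lia.
exact: ExecIf ev E.
Qed.

(** The index of the invariant is a fuel that drops by one per iteration; a loop may exit with fuel
    left. The bound pays for e bodies and e + 1 tests. *)
Lemma runs_while (R : realType) (F : R -> option R) B
    (I : nat -> state R -> Prop) b c s B' e (P : state R -> Prop) :
  (forall e s, I e s -> exists2 v, beval F s b = Some v &
     if v then exists2 e', e = e'.+1 & runs F c s B (I e') else P s) ->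
  I e s -> (e * B + e.+1 * (bcost b + bcalls b).+1 <= B')%N ->
  runs F (While b c) s B' P.
Proof.
move=> H Is le; apply: (@runs_le _ _ _ _ _ _ P _ _ le) => // {le B'}.
elim: e s Is => [|e IH] s Is.
  have [[] ev r] := H _ _ Is; first by case: r.
  by exists s, (bcost b).+1, (bcalls b); split=> //; [exact: ExecWhileF|lia].
have [[] ev r] := H _ _ Is; last first.
  by exists s, (bcost b).+1, (bcalls b); split=> //; [exact: ExecWhileF|lia].
case: r => e' [<-] [s1 [t1 [q1 [E1 b1 Is1]]]].
have [s2 [t2 [q2 [E2 b2 p]]]] := IH _ Is1.
exists s2, (bcost b + t1 + t2).+1, (bcalls b + q1 + q2)%N; split => //.
  exact: ExecWhileT ev E1 E2.
rewrite !mulSn; lia.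
Qed.

(** * The program *)

(* Cell (l + 1) n + s of array vX holds the crossover row of the two halves of
   the block [s, s + 2^(l+1)). *)
Local Notation vn := 0%N.
Local Notation vm := 1%N.
Local Notation vX := 2%N.
Local Notation vh := 3%N.
Local Notation voff := 4%N.
Local Notation vs := 5%N.
Local Notation vk := 6%N.
Local Notation vlo := 7%N.
Local Notation vhi := 8%N.
Local Notation vqh := 9%N.
Local Notation vqoff := 10%N.
Local Notation vqs := 11%N.
Local Notation vjl := 12%N.

Local Notation get x := (NGet x (NConst 0)).
Local Notation set_ x e := (NPut x (NConst 0) e).

(** When the crossover is read, [vqh] is already halved but [vqoff] still points to the level of the
    undivided block; it is lowered afterwards. *)
Definition query_step : com :=
  Seq (set_ vqh (NHalf (get vqh)))
 (Seq (If (BNle (NGet vX (NAdd (get vqoff) (get vqs))) (get vk))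
          Skip (set_ vqs (NAdd (get vqs) (get vqh))))
      (set_ vqoff (NSub (get vqoff) (get vn)))).

(* With vqh = 2^l, vqoff = l n and vqs = s, replaces vqs by the column of the
   minimum of row vk over the block [s, s + 2^l). *)
Definition query : com := While (BNle (NConst 2) (get vqh)) query_step.

Definition value (x : nat) : rexp :=
  RAdd (RGet 0 (get x)) (REvo (RNat (NSub (get x) (get vk)))).

Definition ask (eh eoff es : nexp) : com :=
  Seq (set_ vqh eh) (Seq (set_ vqoff eoff) (Seq (set_ vqs es) query)).

Definition search_step : com :=
  Seq (set_ vk (NHalf (NAdd (get vlo) (get vhi))))
 (Seq (ask (NHalf (get vh)) (NSub (get voff) (get vn)) (get vs))
 (Seq (set_ vjl (get vqs))
 (Seq (ask (NHalf (get vh)) (NSub (get voff) (get vn))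
           (NAdd (get vs) (NHalf (get vh))))
      (If (BRle (value vjl) (value vqs))
          (set_ vhi (get vk))
          (set_ vlo (NAdd (get vk) (NConst 1))))))).

(* Row k has [s, s + h) inside its band exactly when s + h - m <= k <= s. *)
Definition search : com :=
  Seq (set_ vlo (NSub (NAdd (get vs) (get vh)) (get vm)))
 (Seq (set_ vhi (NAdd (get vs) (NConst 1)))
      (While (BNle (NAdd (get vlo) (NConst 1)) (get vhi)) search_step)).

Definition level : com :=
  Seq (set_ vs (NConst 0))
      (While (BNle (NAdd (get vs) (get vh)) (get vn))
         (Seq search
         (Seq (NPut vX (NAdd (get voff) (get vs)) (get vlo))
              (set_ vs (NAdd (get vs) (NConst 1)))))).

Definition build : com :=
  Seq (set_ vh (NConst 2))
 (Seq (set_ voff (get vn))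
      (While (BNle (get vh) (get vm))
         (Seq level
         (Seq (set_ vh (NAdd (get vh) (get vh)))
              (set_ voff (NAdd (get voff) (get vn))))))).

Definition answer_step : com :=
  Seq (ask (get vh) (get voff) (get vk))
 (Seq (set_ vjl (get vqs))
 (Seq (ask (get vh) (get voff) (NSub (NAdd (get vk) (get vm)) (get vh)))
 (Seq (If (BRle (value vjl) (value vqs))
          (RPut 1 (get vk) (value vjl))
          (RPut 1 (get vk) (value vqs)))
      (set_ vk (NAdd (get vk) (NConst 1)))))).

Definition answer : com :=
  Seq (set_ vk (NConst 0))
      (While (BNle (NAdd (get vk) (get vm)) (get vn)) answer_step).

(** [build] stops at the first power of two above m, so block length and table offset are taken one
    level back before the rows are answered. *)
Definition program : com :=
  Seq build
 (Seq (set_ vh (NHalf (get vh)))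
 (Seq (set_ voff (NSub (get voff) (get vn))) answer)).

(** * Correctness and cost *)

(** The frame relation of a subprogram that writes only to the arrays of naturals in [xs]. *)
Definition agree (R : Type) (xs : seq nat) (s s' : state R) :=
  rmem s' = rmem s /\ forall x, x \notin xs -> nmem s' x = nmem s x.

Lemma agree_trans (R : Type) xs (s1 s2 s3 : state R) :
  agree xs s1 s2 -> agree xs s2 s3 -> agree xs s1 s3.
Proof.
by move=> [r1 n1] [r2 n2]; split=> [|x xxs]; rewrite ?r2// n2// n1.
Qed.

Lemma agree_sub (R : Type) (xs ys : seq nat) (s s' : state R) :
  agree xs s s' -> {subset xs <= ys} -> agree ys s s'.
Proof.
move=> [r n] sub; split=> // x xys; apply: n.
by apply: contra xys; exact: sub.
Qed.

Lemma agree_nput (R : Type) xs (s s' : state R) x i v :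
  agree xs s s' -> x \in xs -> agree xs s (nput s' x i v).
Proof.
move=> [r n] xxs; split=> //= y yxs.
rewrite -n //; apply/funext => j; rewrite /upd; case: eqP => [yx|] //=.
by rewrite yx xxs in yxs.
Qed.

Lemma agree_refl (R : Type) xs (s : state R) : agree xs s s.
Proof. by []. Qed.

(** The two bounds on k say that the band of row k contains both halves; only for such rows must [x]
    separate the winners. *)
Definition node_ok (R : realType) m (a : nat -> R) (f : R -> R)
    (x s h : nat) :=
  forall k, (k <= s)%N -> (s + h + h <= k + m)%N ->
  if (x <= k)%N then wins a f k s (s + h)%N h else wins a f k (s + h)%N s h.

Definition table_ok (R : realType) n m (a : nat -> R) (f : R -> R)
    (X : nat -> nat) (l : nat) :=
  forall l' s, (l' < l)%N -> (s + 2 ^ l'.+1 <= n)%N ->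
  node_ok m a f (X (l'.+1 * n + s)%N) s (2 ^ l').

(** * Locating a row minimum inside a block *)

(** The invariant says that a minimum of the current block is a minimum of the original one. The
    oracle is arbitrary, since the descent only compares k with stored crossovers. *)
Lemma query_runs (R : realType) (F : R -> option R) n m (a : nat -> R)
    (f : R -> R) (st : state R) (l L s k : nat) :
  table_ok n m a f (nmem st vX) L -> (l <= L)%N ->
  nmem st vn 0 = n -> nmem st vk 0 = k ->
  nmem st vqh 0 = (2 ^ l)%N -> nmem st vqoff 0 = (l * n)%N ->
  nmem st vqs 0 = s ->
  (s + 2 ^ l <= n)%N -> (k <= s)%N -> (s + 2 ^ l <= k + m)%N ->
  runs F query st (50 * l.+1)
    (fun st' => agree [:: vqh; vqoff; vqs] st st' /\
                argmin a f k s (2 ^ l) (nmem st' vqs 0)).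
Proof.
move=> tab lL stn stk sth stoff sts sn ks skm.
pose I e (st' : state R) :=
  [/\ agree [:: vqh; vqoff; vqs] st st', nmem st' vqh 0 = (2 ^ e)%N,
      nmem st' vqoff 0 = (e * n)%N, (e <= l)%N &
      let s1 := nmem st' vqs 0 in
      [/\ (s <= s1)%N, (s1 + 2 ^ e <= s + 2 ^ l)%N &
      forall j, argmin a f k s1 (2 ^ e) j -> argmin a f k s (2 ^ l) j]].
have I0 : I l st by split=> //; rewrite sts; split.
apply: (runs_while (B := 40) _ I0); last by rewrite /=; lia.
move=> {sth stoff sts} e st' [ag eh eoff el [ss se sarg]].
exists (2 <= nmem st' vqh 0)%N => //; rewrite eh.
case: e => [|e] in eh eoff el se sarg *.
  (* A block of length 2^0 has a single column. *)
  split=> //; apply: sarg; split; first by lia.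
  by move=> j' jb; have -> : j' = nmem st' vqs 0 by lia.
have -> : (2 <= 2 ^ e.+1)%N by rewrite -{1}(expn1 2) leq_exp2l.
exists e => //.
have e2 : (2 ^ e.+1 = 2 ^ e + 2 ^ e)%N by rewrite expnS mul2n addnn.
have half : (nmem st' vqh 0)./2 = (2 ^ e)%N by rewrite eh e2 addnn doubleK.
have agn : nmem st' vn 0 = n by rewrite (proj2 ag).
have agk : nmem st' vk 0 = k by rewrite (proj2 ag).
apply: runs_nput_seq => //=; rewrite half.
set st1 := nput _ _ _ _.
have := tab e (nmem st' vqs 0) (leq_trans el lL).
move=> /(_ ltac:(lia)) /(_ k) /(_ ltac:(lia)) /(_ ltac:(lia)) nok.
have ag1 : agree [:: vqh; vqoff; vqs] st st1 by apply: agree_nput.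
apply: (@runs_seq _ _ _ _ _ 20) => //.
apply: runs_if; [reflexivity| |by []].
rewrite /= /upd /= eoff agk (proj2 ag) //.
case: ifP nok => _ nok.
  apply: runs_skip; apply: runs_nput => //=.
  split=> //=; [exact: agree_nput|by rewrite /upd /= eoff agn; lia|lia|].
  rewrite /upd /=; split; [lia|lia|] => j jm; apply: sarg.
  by rewrite e2; exact: argmin_left.
apply: runs_nput => //; apply: runs_nput => //.
split=> //=; rewrite ?/upd /=.
- by do 2 apply: agree_nput => //.
- by rewrite eoff agn; lia.
- lia.
- split; [lia|lia|] => j jm; apply: sarg.
  by rewrite e2; exact: argmin_right.
Qed.

Lemma reval_value (R : realType) m (a : nat -> R) (f : R -> R) (st : state R)
    x k j :
  rmem st 0 = a -> nmem st vk 0 = k -> nmem st x 0 = j ->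
  (k <= j < k + m)%N ->
  reval (EVO m f) st (value x) = Some (entry a f k j).
Proof.
move=> ra nk nj kj; rewrite /= ra nk nj /EVO ler0n ltr_nat.
by have -> : (j - k < m)%N by lia.
Qed.

(** The assignments are sequential: [eoff] and [es] are evaluated after [vqh], respectively [vqh]
    and [vqoff], have been overwritten. *)
Lemma ask_runs (R : realType) (F : R -> option R) n m (a : nat -> R)
    (f : R -> R) (st : state R) (l L s k : nat) eh eoff es :
  table_ok n m a f (nmem st vX) L -> (l <= L)%N ->
  nmem st vn 0 = n -> nmem st vk 0 = k ->
  neval st eh = (2 ^ l)%N ->
  neval (nput st vqh 0 (2 ^ l)) eoff = (l * n)%N ->
  neval (nput (nput st vqh 0 (2 ^ l)) vqoff 0 (l * n)) es = s ->
  (ncost eh + ncost eoff + ncost es <= 40)%N ->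
  (s + 2 ^ l <= n)%N -> (k <= s)%N -> (s + 2 ^ l <= k + m)%N ->
  runs F (ask eh eoff es) st (50 * l.+1 + 50)
    (fun st' => agree [:: vqh; vqoff; vqs] st st' /\
                argmin a f k s (2 ^ l) (nmem st' vqs 0)).
Proof.
move=> tab lL stn stk eh_ eoff_ es_ cost sn ks skm.
apply: runs_nput_seq; rewrite ?eh_ /=; first lia.
apply: runs_nput_seq; rewrite ?eoff_ /=; first lia.
apply: runs_nput_seq; rewrite ?es_ /=; first lia.
set st3 := nput _ _ _ _.
have : runs F query st3 (50 * l.+1) (fun st' =>
    agree [:: vqh; vqoff; vqs] st3 st' /\ argmin a f k s (2 ^ l) (nmem st' vqs 0)).
  exact: (@query_runs _ _ n m _ _ _ _ L).
move/runs_le; apply; first by lia.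
move=> s' [ag am]; split; last exact: am.
by apply: agree_trans ag; do 3 apply: agree_nput => //.
Qed.

(** * Computing the crossovers level by level *)

(** Binary search on rows: the right half wins below [vlo], the left half from [vhi] on. By
    monotonicity, comparing the two minima in the middle row settles one side; when the bounds meet
    they are a crossover. *)
Lemma search_runs (R : realType) n m (a : nat -> R) (f : R -> R)
    (st : state R) (l L s E : nat) :
  concave_function [set x | 0 <= x < m%:R] f ->
  rmem st 0 = a -> nmem st vn 0 = n -> nmem st vm 0 = m ->
  table_ok n m a f (nmem st vX) l -> (l <= L)%N ->
  nmem st vh 0 = (2 ^ l.+1)%N -> nmem st voff 0 = (l.+1 * n)%N ->
  nmem st vs 0 = s -> (s + 2 ^ l.+1 <= n)%N -> (2 ^ l.+1 <= m)%N ->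
  (m < 2 ^ E)%N ->
  runs (EVO m f) search st (E.+1 * (100 * L.+1 + 300))
    (fun st' => agree [:: vk; vlo; vhi; vqh; vqoff; vqs; vjl] st st' /\
                node_ok m a f (nmem st' vlo 0) s (2 ^ l)).
Proof.
move=> cf sta stn stm tab lL sth stoff sts sn hm mE.
set fr := [:: _; _; _; _; _; _; _].
have e2 : (2 ^ l.+1 = 2 ^ l + 2 ^ l)%N by rewrite expnS mul2n addnn.
have e0 : (0 < 2 ^ l)%N by rewrite expn_gt0.
apply: runs_nput_seq => /=; first lia.
apply: runs_nput_seq => /=; first lia.
rewrite /upd /= sts sth stm.
set st1 := nput _ _ _ _.
have ag1 : agree fr st st1 by do 2 apply: agree_nput => //.
have search_ask st0 k s0 es : agree fr st st0 -> nmem st0 vk 0 = k ->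
    neval (nput (nput st0 vqh 0 (2 ^ l)) vqoff 0 (l * n)) es = s0 ->
    (ncost es <= 20)%N ->
    (s0 + 2 ^ l <= n)%N -> (k <= s0)%N -> (s0 + 2 ^ l <= k + m)%N ->
    runs (EVO m f) (ask (NHalf (get vh)) (NSub (get voff) (get vn)) es)
      st0 (50 * l.+1 + 50) (fun st' => agree [:: vqh; vqoff; vqs] st0 st' /\
                                       argmin a f k s0 (2 ^ l) (nmem st' vqs 0)).
  move=> ag k0 es0 ces *; apply: (@ask_runs _ _ n m a f st0 l l) => //=;
    rewrite /upd /= ?(proj2 ag) //; [|by rewrite stoff stn mulSn addnC addnK|lia].
  by rewrite sth e2 addnn doubleK.
pose I e (st' : state R) :=
  [/\ agree fr st st',
      (nmem st' vlo 0 <= nmem st' vhi 0 <= s.+1)%N,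
      (nmem st' vhi 0 - nmem st' vlo 0 < 2 ^ e)%N,
      (s + 2 ^ l.+1 - m <= nmem st' vlo 0)%N &
      forall k, (k <= s)%N -> (s + 2 ^ l + 2 ^ l <= k + m)%N ->
      ((k < nmem st' vlo 0)%N -> wins a f k (s + 2 ^ l)%N s (2 ^ l)) /\
      ((nmem st' vhi 0 <= k)%N -> wins a f k s (s + 2 ^ l)%N (2 ^ l))].
(* Both claims on winners are vacuous at first, since the band of a row below s + 2^(l+1) - m or
   above s does not contain the block. Fewer than m + 1 rows remain, and m < 2^E. *)
have I0 : I E st1.
  split; rewrite /st1 //= /upd /=; [lia|lia|].
  by move=> k ks skm; split; lia.
apply: (runs_while (B := 100 * L.+1 + 250) _ I0); last by rewrite /=; nia.
move=> {ag1 st1 I0 mE E} e st1 [ag1 lohi ehi lo0 Hk].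
have [r1 n1] := ag1.
have half1 : (2 ^ l.+1)./2 = (2 ^ l)%N by rewrite e2 addnn doubleK.
exists (nmem st1 vlo 0 + 1 <= nmem st1 vhi 0)%N => //.
case: ifP => lohi1; last first.
  split=> // k ks skm; have [H1 H2] := Hk k ks skm.
  by case: leqP => kx; [apply: H2; lia|exact: H1].
case: e ehi => [|e] ehi; first by move: ehi; rewrite expn0; lia.
exists e => //.
apply: runs_nput_seq => /=; first lia.
set k := (_./2)%N; set st2 := nput _ _ _ _.
(* Being at least [vlo] and strictly below [vhi], row k has the whole block in its band, so both
   halves can be queried. *)
have kb : (nmem st1 vlo 0 <= k < nmem st1 vhi 0)%N by rewrite /k; lia.
have ke : (k - nmem st1 vlo 0 < 2 ^ e)%N /\ (nmem st1 vhi 0 - k.+1 < 2 ^ e)%N.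
  by move: ehi; rewrite expnS /k; lia.
have ag2 : agree fr st st2 by apply: agree_nput.
apply: (@runs_seq _ _ _ _ _ (50 * L.+1 + 50)); last lia.
have : runs (EVO m f) (ask (NHalf (get vh)) (NSub (get voff) (get vn)) (get vs))
    st2 (50 * l.+1 + 50) (fun st' => agree [:: vqh; vqoff; vqs] st2 st' /\
                                     argmin a f k s (2 ^ l) (nmem st' vqs 0)).
  have st2k : nmem st2 vk 0 = k by [].
  apply: (search_ask _ _ _ _ ag2) => //; rewrite /= ?/upd /= ?(proj2 ag1) //; lia.
move/runs_le; apply; first lia; move=> st3 [[r3 n3] am1].
have ag3 : agree fr st st3.
  apply: agree_trans ag2 _; apply: (agree_sub (conj r3 n3)) => x.
  by rewrite !inE => /or3P[] /eqP->.
apply: runs_nput_seq => /=; first lia.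
set st4 := nput _ _ _ _.
have ag4 : agree fr st st4 by apply: agree_nput.
apply: (@runs_seq _ _ _ _ _ (50 * L.+1 + 50)); last lia.
have : runs (EVO m f) (ask (NHalf (get vh)) (NSub (get voff) (get vn))
                           (NAdd (get vs) (NHalf (get vh))))
    st4 (50 * l.+1 + 50) (fun st' => agree [:: vqh; vqoff; vqs] st4 st' /\
                             argmin a f k (s + 2 ^ l) (2 ^ l) (nmem st' vqs 0)).
  have st4k : nmem st4 vk 0 = k by rewrite /st4 /= /upd /= n3.
  apply: (search_ask _ _ _ _ ag4) => //; rewrite /= ?/upd /= ?(proj2 ag3)
    ?sth ?sts ?e2 ?addnn ?doubleK //; lia.
move/runs_le; apply; first lia; move=> st5 [[r5 n5] am2].
have ag5 : agree fr st st5.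
  apply: agree_trans ag4 _; apply: (agree_sub (conj r5 n5)) => x.
  by rewrite !inE => /or3P[] /eqP->.
have st5k : nmem st5 vk 0 = k by rewrite n5 // /st4 /= /upd /= n3.
have st5jl : nmem st5 vjl 0 = nmem st3 vqs 0 by rewrite n5.
have st5lo : nmem st5 vlo 0 = nmem st1 vlo 0 by rewrite n5 // /st4 /= /upd /= n3.
have st5hi : nmem st5 vhi 0 = nmem st1 vhi 0 by rewrite n5 // /st4 /= /upd /= n3.
have r50 : rmem st5 0 = a by rewrite r5 /= r3 /= r1.
have [b1 _] := am1; have [b2 _] := am2.
have v1 : reval (EVO m f) st5 (value vjl) = Some (entry a f k (nmem st3 vqs 0)).
  by apply: reval_value => //; lia.
have v2 : reval (EVO m f) st5 (value vqs) = Some (entry a f k (nmem st5 vqs 0)).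
  by apply: reval_value => //; lia.
apply: runs_if; [by rewrite /beval v1 v2| |by rewrite /=; lia].
case: ifP => [le12|gt12]; apply: runs_nput; rewrite /= ?st5k; try lia.
  have w := argmin_wins am1 am2 le12.
  split; rewrite /= /upd /= ?st5lo; [exact: agree_nput|lia|lia|lia|].
  move=> k' k's k'm; have [H1 H2] := Hk k' k's k'm; split=> // kk'.
  by apply: (wins_mono cf kk' _ _ w); lia.
have w : wins a f k (s + 2 ^ l)%N s (2 ^ l).
  by apply: argmin_wins am2 am1 _; rewrite ltW // ltNge gt12.
split; rewrite /= /upd /= ?st5hi; [exact: agree_nput|lia|lia|lia|].
move=> k' k's k'm; have [H1 H2] := Hk k' k's k'm; split=> // kk'.
by apply: (wins_antimono cf (k' := k') _ _ _ w); lia.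
Qed.

Lemma level_runs (R : realType) n m (a : nat -> R) (f : R -> R)
    (st : state R) (l L E : nat) :
  concave_function [set x | 0 <= x < m%:R] f ->
  rmem st 0 = a -> nmem st vn 0 = n -> nmem st vm 0 = m ->
  table_ok n m a f (nmem st vX) l -> (l <= L)%N ->
  nmem st vh 0 = (2 ^ l.+1)%N -> nmem st voff 0 = (l.+1 * n)%N ->
  (2 ^ l.+1 <= m)%N -> (m < 2 ^ E)%N ->
  runs (EVO m f) level st (n.+1 * (E.+1 * (100 * L.+1 + 300) + 50))
    (fun st' => agree [:: vX; vs; vk; vlo; vhi; vqh; vqoff; vqs; vjl] st st' /\
                table_ok n m a f (nmem st' vX) l.+1).
Proof.
move=> cf sta stn stm tab lL sth stoff hm mE.
set fr := [:: _; _; _; _; _; _; _; _; _].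
have e0 : (0 < 2 ^ l.+1)%N by rewrite expn_gt0.
set C := (E.+1 * _)%N.
apply: runs_nput_seq => /=; first lia.
set st0 := nput _ _ _ _.
(* The fuel is n - s; the loop already stops when the block no longer fits into the n columns. *)
pose I e (st' : state R) :=
  [/\ agree fr st st', (e + nmem st' vs 0 = n)%N,
      table_ok n m a f (nmem st' vX) l &
      forall s, (s < nmem st' vs 0)%N -> (s + 2 ^ l.+1 <= n)%N ->
      node_ok m a f (nmem st' vX (l.+1 * n + s)%N) s (2 ^ l)].
have I0 : I n st0 by split=> //=; [exact: agree_nput|rewrite /upd /=; lia].
apply: (runs_while (B := C + 30) _ I0); last by rewrite /=; nia.
move=> {st0 I0} e st1 [ag1 es tab1 nod1].
have st1h : nmem st1 vh 0 = (2 ^ l.+1)%N by rewrite (proj2 ag1).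
have st1n : nmem st1 vn 0 = n by rewrite (proj2 ag1).
exists (nmem st1 vs 0 + 2 ^ l.+1 <= n)%N; first by rewrite /= st1h st1n.
case: ifP => sn; last first.
  split=> // l' s; rewrite ltnS leq_eqVlt => /orP[/eqP->|l'l]; last exact: tab1.
  by move=> s'n; apply: nod1 => //; lia.
case: e es => [|e] es; first lia.
exists e => //.
have H : runs (EVO m f) search st1 C (fun st' =>
    agree [:: vk; vlo; vhi; vqh; vqoff; vqs; vjl] st1 st' /\
    node_ok m a f (nmem st' vlo 0) (nmem st1 vs 0) (2 ^ l)).
  by apply: (@search_runs _ n) => //; rewrite ?(proj2 ag1) // (proj1 ag1).
apply: (@runs_seq _ _ _ _ _ C); last lia.
move: H => /runs_le; apply=> // st2 [[r2 n2] nod2].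
have ag2 : agree fr st st2.
  apply: agree_trans ag1 _; apply: (agree_sub (conj r2 n2)) => x.
  by apply/allP: x.
have st2s : nmem st2 vs 0 = nmem st1 vs 0 by rewrite n2.
have st2X : nmem st2 vX = nmem st1 vX by rewrite n2.
have st2off : nmem st2 voff 0 = (l.+1 * n)%N by rewrite (proj2 ag2).
apply: runs_nput_seq => /=; first lia.
apply: runs_nput => /=; last lia.
rewrite st2off /upd /= st2s.
split=> /=.
- by do 2 apply: agree_nput => //.
- by rewrite /upd /=; lia.
- move=> l' s l'l sn'; rewrite /upd /=; case: eqP => [eqi|_].
    (* Since s < n, a cell of an earlier level lies below (l' + 2) n <= (l + 1) n, so it is not
       overwritten. *)
    by have : (l'.+1 * n + n <= l.+1 * n)%N; [rewrite -mulSnr leq_mul2r; lia|lia].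
  by rewrite st2X; exact: tab1.
- move=> s; rewrite /upd /= addn1 ltnS => sle sn'.
  case: eqP => [eqi|neq]; first by have -> : s = nmem st1 vs 0 by lia.
  by rewrite st2X; apply: nod1 => //; lia.
Qed.

Lemma build_runs (R : realType) n m (a : nat -> R) (f : R -> R)
    (st : state R) (L : nat) :
  concave_function [set x | 0 <= x < m%:R] f ->
  rmem st 0 = a -> nmem st vn 0 = n -> nmem st vm 0 = m ->
  (2 ^ L <= m < 2 ^ L.+1)%N ->
  runs (EVO m f) build st
    (L.+1 * (n.+1 * (L.+2 * (100 * L.+1 + 300) + 50) + 50))
    (fun st' => [/\ rmem st' = rmem st, nmem st' vn 0 = n, nmem st' vm 0 = m,
       table_ok n m a f (nmem st' vX) L &
       nmem st' vh 0 = (2 ^ L.+1)%N /\ nmem st' voff 0 = (L.+1 * n)%N]).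
Proof.
move=> cf sta stn stm /andP[Lm0 Lm1].
set C := (n.+1 * _)%N.
apply: runs_nput_seq => /=; first lia.
apply: runs_nput_seq => /=; first lia.
set st0 := nput _ _ _ _.
(* Here l counts the completed levels and the fuel is L - l; the loop test 2^(l+1) <= m first fails
   at l = L. *)
pose I e (st' : state R) := exists l,
  [/\ rmem st' = rmem st, nmem st' vn 0 = n, nmem st' vm 0 = m,
       table_ok n m a f (nmem st' vX) l &
       [/\ nmem st' vh 0 = (2 ^ l.+1)%N, nmem st' voff 0 = (l.+1 * n)%N &
           (e + l = L)%N]].
have I0 : I L st0 by exists 0%N; split=> //; split=> //=; rewrite /upd /= ?stn; lia.
apply: (runs_while (B := C + 30) _ I0); last by rewrite /=; nia.
move=> {st0 I0} e st1 [l [r1 n1 m1 tab1 [h1 off1 el]]].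
exists (2 ^ l.+1 <= m)%N; first by rewrite /= h1 m1.
case: e el => [|e] el.
  have lL : l = L by lia.
  by rewrite -{}lL in Lm1 *; rewrite leqNgt Lm1.
have hm : (2 ^ l.+1 <= m)%N.
  by apply: leq_trans Lm0; rewrite leq_exp2l; lia.
rewrite hm; exists e => //.
have := @level_runs R n m a f st1 l L L.+1 cf.
rewrite r1 => /(_ sta n1 m1 tab1 ltac:(lia) h1 off1 hm Lm1) H.
apply: (@runs_seq _ _ _ _ _ C); last lia.
move: H => /runs_le; apply=> // st2 [ag2 tab2].
apply: runs_nput_seq => /=; first lia.
apply: runs_nput => /=; last lia.
exists l.+1; split=> //=; rewrite ?/upd /= ?(proj2 ag2) //.
  by rewrite (proj1 ag2).
by rewrite h1 off1 n1; split; [rewrite [in RHS]expnS; lia|lia|lia].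
Qed.

(** * Answering the rows *)

(** As m <= 2h, the prefix and the suffix of length h cover [k, k + m); their overlap is harmless
    for a minimum. *)
Lemma argmin_cover (R : realType) (a : nat -> R) (f : R -> R) k m h j1 j2 :
  (h <= m <= h + h)%N -> argmin a f k k h j1 -> argmin a f k (k + m - h) h j2 ->
  argmin a f k k m (if entry a f k j1 <= entry a f k j2 then j1 else j2).
Proof.
move=> hm [b1 m1] [b2 m2]; split=> [|j jb]; first by case: ifP => _; lia.
case: (leP (entry a f k j1) (entry a f k j2)) => [le12|/ltW le21].
  have [jh|jh] := ltnP j (k + h); first by apply: m1; lia.
  by apply: le_trans le12 _; apply: m2; lia.
have [jh|jh] := ltnP j (k + h); last by apply: m2; lia.
by apply: le_trans le21 _; apply: m1; lia.
Qed.

(** The starting value of the iterated minimum is the entry of column k, so it adds no candidate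
    outside the band. *)
Lemma min_plus_argmin (R : realType) n m (a : n.-tuple R) (f : R -> R) k j :
  argmin (nth 0 a) f k k m j -> min_plus m a f k = entry (nth 0 a) f k j.
Proof.
move=> [jb jm].
have e0 : a`_k + f 0 = entry (nth 0 a) f k k by rewrite /entry subnn.
apply/le_anti/andP; split; rewrite /min_plus big_mkord.
  have jk : (j - k < m)%N by lia.
  apply: le_trans (bigmin_le _ (Ordinal jk) _) _ => /=.
  by rewrite /entry subnKC //; lia.
apply: le_bigmin => [|i _]; first by rewrite e0; apply: jm; lia.
have -> : a`_(k + i) + f (i : nat)%:R = entry (nth 0 a) f k (k + i).
  by rewrite /entry addKn.
by apply: jm; have := ltn_ord i; lia.
Qed.

Lemma answer_runs (R : realType) n m (a : n.-tuple R) (f : R -> R)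
    (st : state R) (L : nat) :
  (m <= n)%N -> rmem st 0 = nth 0 a -> nmem st vn 0 = n -> nmem st vm 0 = m ->
  table_ok n m (nth 0 a) f (nmem st vX) L ->
  nmem st vh 0 = (2 ^ L)%N -> nmem st voff 0 = (L * n)%N ->
  (2 ^ L <= m < 2 ^ L.+1)%N ->
  runs (EVO m f) answer st (n.+1 * (100 * L.+1 + 300))
    (fun st' => forall k, (k <= n - m)%N -> output st' k = min_plus m a f k).
Proof.
move=> mn sta stn stm tab sth stoff Lm.
set fr := [:: vk; vqh; vqoff; vqs; vjl].
have e0 : (0 < 2 ^ L)%N by rewrite expn_gt0.
rewrite expnS in Lm.
apply: runs_nput_seq => /=; first lia.
set st0 := nput _ _ _ _.
pose I e (st' : state R) :=
  [/\ rmem st' 0 = nth 0 a, forall x, x \notin fr -> nmem st' x = nmem st x,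
      (e + nmem st' vk 0 = n)%N &
      forall k, (k < nmem st' vk 0)%N -> rmem st' 1 k = min_plus m a f k].
have I0 : I n st0.
  split=> //=; last by rewrite /upd /=; lia.
  exact: (proj2 (agree_nput _ _ (agree_refl _ _) _)).
apply: (runs_while (B := 100 * L.+1 + 250) _ I0); last by rewrite /=; nia.
move=> {st0 I0} e st1 [r1 n1 ek out1].
set k := nmem st1 vk 0 in ek out1.
exists (k + m <= n)%N; first by rewrite /= -/k (n1 vm) // (n1 vn) // stm stn.
case: ifP => km; last by move=> k' k'm; apply: out1; lia.
case: e ek => [|e] ek; first lia.
exists e => //.
(* Both queries of a row are at level L; they differ only in the block start, k or k + m - 2^L. *)
have ask1 st2 s0 es : agree fr st1 st2 -> nmem st2 vk 0 = k ->
    neval (nput (nput st2 vqh 0 (2 ^ L)) vqoff 0 (L * n)) es = s0 ->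
    (ncost es <= 20)%N ->
    (s0 + 2 ^ L <= n)%N -> (k <= s0)%N -> (s0 + 2 ^ L <= k + m)%N ->
    runs (EVO m f) (ask (get vh) (get voff) es)
      st2 (50 * L.+1 + 50) (fun st' => agree [:: vqh; vqoff; vqs] st2 st' /\
                               argmin (nth 0 a) f k s0 (2 ^ L) (nmem st' vqs 0)).
  move=> ag k0 es0 ces *; apply: (@ask_runs _ _ n m _ f st2 L L) => //=;
    rewrite /upd /= ?(proj2 ag) ?n1 //; lia.
apply: (@runs_seq _ _ _ _ _ (50 * L.+1 + 50)); last lia.
have /runs_le := ask1 _ k (get vk) (agree_refl fr st1) erefl erefl isT
  ltac:(lia) ltac:(lia) ltac:(lia).
apply; first by []; move=> st2 [[r2 n2] am1].
apply: runs_nput_seq => /=; first lia.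
set st3 := nput _ _ _ _.
have ag3 : agree fr st1 st3.
  apply: agree_nput => //; apply: (agree_sub (conj r2 n2)) => x.
  by apply/allP: x.
have st3k : nmem st3 vk 0 = k by rewrite /st3 /= /upd /= n2.
apply: (@runs_seq _ _ _ _ _ (50 * L.+1 + 50)); last lia.
have es3 : neval (nput (nput st3 vqh 0 (2 ^ L)) vqoff 0 (L * n))
    (NSub (NAdd (get vk) (get vm)) (get vh)) = (k + m - 2 ^ L)%N.
  by rewrite /= /upd /= !n2 // -/k (n1 vm) // (n1 vh) // sth stm.
have /runs_le := ask1 _ _ _ ag3 st3k es3 isT ltac:(lia) ltac:(lia) ltac:(lia).
apply; first lia; move=> st4 [[r4 n4] am2].
have ag4 : agree fr st1 st4.
  apply: agree_trans ag3 _; apply: (agree_sub (conj r4 n4)) => x.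
  by apply/allP: x.
have st4k : nmem st4 vk 0 = k by rewrite n4.
have st4jl : nmem st4 vjl 0 = nmem st2 vqs 0 by rewrite n4.
have r40 : rmem st4 0 = nth 0 a by rewrite (proj1 ag4).
have [b1 _] := am1; have [b2 _] := am2.
have v1 : reval (EVO m f) st4 (value vjl) =
    Some (entry (nth 0 a) f k (nmem st2 vqs 0)).
  by apply: reval_value => //; lia.
have v2 : reval (EVO m f) st4 (value vqs) =
    Some (entry (nth 0 a) f k (nmem st4 vqs 0)).
  by apply: reval_value => //; lia.
have hm : (2 ^ L <= m <= 2 ^ L + 2 ^ L)%N by lia.
have /min_plus_argmin mp := argmin_cover hm am1 am2.
apply: (@runs_seq _ _ _ _ _ 80); last lia.
apply: runs_if; [by rewrite /beval v1 v2| |by []].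
(* Either branch stores the same value, so one final state serves both. *)
have fin : I e (nput (rput st4 1 k (min_plus m a f k)) vk 0 (k + 1)).
  split=> //=.
  - move=> x xfr; rewrite -n1 // -(proj2 ag4) //; apply/funext => i.
    by rewrite /upd; case: eqP => // xk; rewrite xk in xfr.
  - by rewrite /upd /=; lia.
  - move=> k'; rewrite /upd /= addn1 ltnS => k'k; case: eqP => [->//|neq].
    by rewrite (proj1 ag4); apply: out1; lia.
move: mp; case: ifP => le12 mp.
  apply: (runs_rput v1) => //=; rewrite st4k -mp.
  by apply: runs_nput => /=; [rewrite st4k|lia].
apply: (runs_rput v2) => //=; rewrite st4k -mp.
by apply: runs_nput => /=; [rewrite st4k|lia].
Qed.

(** * Total cost and its asymptotic bound *)

(** The three factors L + 3 come from the levels, the binary search and the descent. The summands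
    are bounded by 300, 20 and 200 times N (L + 3)^3. *)
Lemma program_cost_le (N L : nat) : (0 < N)%N ->
  (L.+1 * (N * (L.+2 * (100 * L.+1 + 300) + 50) + 50) + 20
    + N * (100 * L.+1 + 300) <= 600 * N * L.+3 ^ 3)%N.
Proof.
move=> N0; rewrite !expnS expn0 muln1.
have c1 : (100 * L.+1 + 300 <= 200 * L.+3)%N by lia.
have c2 : (L.+2 * (100 * L.+1 + 300) <= 200 * (L.+3 * L.+3))%N.
  by rewrite mulnCA leq_mul.
set c := (L.+2 * _)%N in c2 *.
have x1 : (1 <= L.+3 * L.+3)%N by rewrite muln_gt0.
have c3 : (N * (c + 50) + 50 <= 300 * (N * (L.+3 * L.+3)))%N by nia.
have c4 : (L.+1 * (N * (c + 50) + 50) <= 300 * (N * (L.+3 * (L.+3 * L.+3))))%N.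
  by rewrite !(mulnCA _ L.+3) leq_mul //; lia.
have c5 : (N * (100 * L.+1 + 300) <= 200 * (N * (L.+3 * (L.+3 * L.+3))))%N.
  rewrite (mulnCA 200) leq_mul // (leq_trans c1) // leq_mul //.
  by rewrite leq_pmulr.
have c6 : (1 <= N * (L.+3 * (L.+3 * L.+3)))%N by rewrite !muln_gt0 N0.
lia.
Qed.

Lemma program_runs (R : realType) n m (a : n.-tuple R) (f : R -> R) :
  (0 < m)%N -> (m <= n)%N ->
  concave_function [set x | 0 <= x < m%:R] f ->
  runs (EVO m f) program (input m a) (600 * n.+1 * (trunc_log 2 n).+3 ^ 3)
    (fun st' => forall k, (k <= n - m)%N -> output st' k = min_plus m a f k).
Proof.
move=> m0 mn cf.
set L := trunc_log 2 m.
have Lm : (2 ^ L <= m < 2 ^ L.+1)%N by exact: trunc_log_bounds.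
have LL : (L <= trunc_log 2 n)%N by exact: leq_trunc_log.
set B1 := (L.+1 * (n.+1 * (L.+2 * (100 * L.+1 + 300) + 50) + 50))%N.
set B2 := (n.+1 * (100 * L.+1 + 300))%N.
apply: (@runs_le _ _ _ _ (B1 + 20 + B2) _
  (fun st' => forall k, (k <= n - m)%N -> output st' k = min_plus m a f k)) => //; last first.
  apply: (@leq_trans (600 * n.+1 * L.+3 ^ 3)); last first.
    by rewrite leq_pmul2l // leq_exp2r.
  exact: program_cost_le.
apply: (@runs_seq _ _ _ _ _ B1); last lia.
have /runs_le := @build_runs R n m (nth 0 a) f (input m a) L cf erefl erefl erefl Lm.
apply; first by [].
move=> st1 [r1 n1 m1 tab1 [h1 off1]].
apply: runs_nput_seq => /=; first lia.
apply: runs_nput_seq => /=; first lia.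
set st2 := nput _ _ _ _.
have st2h : nmem st2 vh 0 = (2 ^ L)%N.
  by rewrite /st2 /= /upd /= h1 expnS mul2n doubleK.
have st2off : nmem st2 voff 0 = (L * n)%N.
  by rewrite /st2 /= /upd /= off1 n1 mulSn addnC addnK.
have r2 : rmem st2 0 = nth 0 a by rewrite /= r1.
have /runs_le := answer_runs mn r2 n1 m1 tab1 st2h st2off Lm.
by apply=> //; lia.
Qed.

(** One of the three logarithms is absorbed by n^(1/3); the other two remain. *)
Lemma cost_bigO (R : realType) (c : nat) :
  ((fun n : nat => (c * n.+1 * (trunc_log 2 n).+3 ^ 3)%:R) : nat -> R) =O_\oo
  (fun n : nat => n%:R `^ (4 / 3) * ln n%:R ^+ 2).
Proof.
have ln2 : 0 < ln 2 :> R by rewrite ln_gt0 // ltr1n.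
pose d : R := 4 / ln 2.
have d0 : 0 < d by rewrite divr_gt0.
have c0 : 0 <= c%:R :> R by [].
have c1 : 0 < c%:R + 1 :> R by rewrite ltr_wpDl.
have C0 : 0 < (c%:R + 1) * 2 * d ^+ 3 * 3 by repeat apply: mulr_gt0 => //; exact: exprn_gt0.
(* The factor 2 comes from n + 1 <= 2n, d^3 from L + 3 <= 4L <= d ln n, and 3 from ln n <= 3
   n^(1/3); c + 1 keeps the constant positive when c = 0. *)
apply/eqO_exP; exists ((c%:R + 1) * 2 * d ^+ 3 * 3); first exact: C0.
near=> n.
have n2 : (2 <= n)%N by near: n; exact: nbhs_infty_ge.
have Lb : (2 ^ trunc_log 2 n <= n)%N by apply: trunc_logP => //; lia.
have L1 : (1 <= trunc_log 2 n)%N by apply: trunc_log_max.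
move: (trunc_log 2 n) Lb L1 => L Lb L1.
have L4 : (L.+3 <= 4 * L)%N by lia.
have n12 : (n.+1 <= 2 * n)%N by lia.
have n0 : 0 < n%:R :> R by rewrite ltr0n; lia.
have Lln : L%:R * ln 2 <= ln n%:R :> R.
  by rewrite mulr_natl -lnXn // ler_ln ?posrE ?exprn_gt0 // -natrX ler_nat.
have ln0 : 0 <= ln n%:R :> R by rewrite ln_ge0 // ler1n; lia.
have p0 : 0 < n%:R `^ (1 / 3) :> R by rewrite powR_gt0.
have lnp : ln n%:R <= 3 * n%:R `^ (1 / 3) :> R.
  (* This is ln y < y at y = n^(1/3). *)
  have := ltW (ln_sublinear p0); rewrite ln_powR; lra.
have -> : n%:R `^ (4 / 3) = n%:R * n%:R `^ (1 / 3) :> R.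
  have -> : 4 / 3 = 1 + 1 / 3 :> R by field.
  by rewrite powRD ?powRr1 ?ltW // gt_eqF ?implybT.
have r0 : 0 <= n%:R * n%:R `^ (1 / 3) * ln n%:R ^+ 2 :> R.
  by rewrite mulr_ge0 ?exprn_ge0 // mulr_ge0 // ltW.
rewrite ger0_norm ?ler0n // ger0_norm //.
have Ld : (L.+3)%:R <= d * ln n%:R :> R.
  rewrite /d mulrAC ler_pdivlMr //.
  apply: (@le_trans _ _ (4 * (L%:R * ln 2))); last by rewrite ler_pM2l.
  by rewrite mulrA ler_pM2r // -natrM ler_nat.
have n1 : (n.+1)%:R <= 2 * n%:R :> R by rewrite -natrM ler_nat.
rewrite natrM natrX natrM.
apply: (@le_trans _ _ ((c%:R + 1) * (2 * n%:R) * (d * ln n%:R) ^+ 3)).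
  apply: ler_pM; rewrite ?mulr_ge0 ?exprn_ge0 //.
    by apply: ler_pM => //; rewrite lerDl.
  by rewrite lerXn2r // nnegrE // (le_trans _ Ld).
have k0 : 0 <= (c%:R + 1) * (2 * n%:R) * d ^+ 3 * ln n%:R ^+ 2.
  apply: mulr_ge0; last exact: exprn_ge0.
  apply: mulr_ge0; last by rewrite exprn_ge0 // ltW.
  by apply: mulr_ge0; rewrite ?mulr_ge0 // ltW.
have := ler_wpM2l k0 lnp.
by rewrite !exprMn (exprS (ln n%:R) 2); lra.
Unshelve. all: by end_near.
Qed.

Unset Implicit Arguments.
Set Strict Implicit.

Theorem theorem3 (R : realType) :
  exists (p : com) (T Q : nat -> R),
    [/\ T =O_\oo (fun n : nat => n%:R `^ (4 / 3) * ln n%:R ^+ 2),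
        Q =O_\oo (fun n : nat => n%:R `^ (4 / 3) * ln n%:R ^+ 2) &
        forall (n m : nat) (a : n.-tuple R) (f : R -> R),
          (0 < m)%N -> (m <= n)%N ->
          concave_function [set x | 0 <= x < m%:R] f ->
          exists (s : state R) (t q : nat),
            [/\ exec (EVO m f) p (input m a) s t q,
                t%:R <= T n,
                q%:R <= Q n &
                forall k : nat, (k <= n - m)%N ->
                  output s k = min_plus m a f k]].
Proof.
(* [runs] bounds the sum of operations and oracle calls, so one function serves as both bounds. *)
pose T : nat -> R := fun n => (600 * n.+1 * (trunc_log 2 n).+3 ^ 3)%:R.
exists program, T, T; split; [exact: cost_bigO..|].
move=> n m a f m0 mn cf.
have [s [t [q [E tq out]]]] := program_runs a m0 mn cf.
by exists s, t, q; split; rewrite // ler_nat; lia.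
Qed.
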